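(* Let $k\ge 1$ and let $\mathcal{H}=\{h_1,\ldots,h_{2k+1}\}$ be an arrangement of $2k+1$ hyperplanes in $\mathbb{R}^k$ in general position, where $h_i=\{\vec x\in\mathbb{R}^k:\langle \vec n_i,\vec x\rangle=b_i\}$. Let $p$ be a prime. Any $AC^0[p]$ circuit of depth $d$ computing $f_{\mathcal{H}}$ requires $\exp(\Omega(k^{1/(2d)}))$ gates.
   Context: For hyperplanes $h_i=\{\vec x:\langle\vec n_i,\vec x\rangle=b_i\}$, $i\in[m]$, in $\mathbb{R}^k$ (with $\vec n_i\neq 0$), the function $f_{\mathcal{H}}:\{-1,1\}^m\to\{0,1\}$ is defined by $f_{\mathcal{H}}(s)=1$ if and only if there exists $\vec x\in\mathbb{R}^k$ with $\mathrm{sign}(\langle \vec x,\vec n_i\rangle-b_i)=s_i$ for all $i\in[m]$ (i.e. the strict linear system with orientations given by $s$ is feasible). The hyperplanes are fixed; only $s$ is the input (each coordinate encoded by one input bit). The arrangement is in general position if any $j\le k$ of the hyperplanes intersect in an affine subspace of dimension $k-j$ and any $k+1$ of them have empty intersection (equivalently, every $k$ normal vectors are linearly independent and every $k+1$ hyperplanes have empty common intersection). An $AC^0[p]$ circuit is a circuit with unbounded fan-in AND, OR, and MOD$_p$ gates and NOT gates; its depth is the length of the longest input-output path and its size is its number of gates. *)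

(* Defs.v *)
From HB Require Import structures.
From mathcomp Require Import all_boot all_order all_algebra.
From mathcomp Require Import all_classical all_reals all_analysis.

Set Implicit Arguments.
Unset Strict Implicit.
Unset Printing Implicit Defensive.

Import Order.TTheory GRing.Theory Num.Theory.
Local Open Scope ring_scope.

Section Arrangements.
Variables (R : realType) (k : nat).

Definition dotp (u v : 'rV[R]_k) : R := \sum_(l < k) u 0 l * v 0 l.

Record arrangement (m : nat) := Arrangement {
  normal : 'I_m -> 'rV[R]_k;
  offset : 'I_m -> R;
  normal_neq0 : forall i, normal i != 0
}.

Definition on_hyperplane m (H : arrangement m) (i : 'I_m) (x : 'rV[R]_k) : Prop :=
  dotp (normal H i) x = offset H i.

Definition common_points m (H : arrangement m) (J : {set 'I_m})
    (x : 'rV[R]_k) : Prop :=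
  forall i, i \in J -> on_hyperplane H i x.

Definition affine_subspace_of_dim (e : nat) (A : 'rV[R]_k -> Prop) : Prop :=
  exists (x0 : 'rV[R]_k) (V : {vspace 'rV[R]_k}),
    \dim V = e /\ forall x, A x <-> x - x0 \in V.

Definition general_position m (H : arrangement m) : Prop :=
  (forall J : {set 'I_m}, (#|J| <= k)%N ->
     affine_subspace_of_dim (k - #|J|) (common_points H J)) /\
  (forall J : {set 'I_m}, #|J| = k.+1 -> forall x, ~ common_points H J x).

(* The input bit true encodes the sign +1, and false encodes -1. *)
Definition sign_of_bit (s : bool) : R := if s then 1 else -1.

Definition f_arr m (H : arrangement m) (s : 'I_m -> bool) : bool :=
  `[< exists x : 'rV[R]_k, forall i,
        Num.sg (dotp x (normal H i) - offset H i) = sign_of_bit (s i) >].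

End Arrangements.

(* Gates reading wires in W; fan-in is unbounded, may be 0, and a wire may be
   fed several times into the same gate. *)
Inductive gate (W : Type) : Type :=
| AndGate of seq W
| OrGate of seq W
| ModGate of seq W
| NotGate of W.

Definition gate_inputs (W : Type) (g : gate W) : seq W :=
  match g with
  | AndGate a | OrGate a | ModGate a => a
  | NotGate w => [:: w]
  end.

(* Convention: MOD_p outputs 1 iff the number of its inputs equal to 1 is
   divisible by p. *)
Definition gate_val (p : nat) (W : Type) (v : W -> bool) (g : gate W) : bool :=
  match g with
  | AndGate a => all v a
  | OrGate a => has v a
  | ModGate a => (p %| count v a)%N
  | NotGate w => ~~ v w
  end.

(* A circuit DAG is given by its gates in topological order.  After S gates
   there are n + S wires: None is the output of the most recent gate, Some w an
   older wire, and the innermost wires are the n inputs. *)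
Fixpoint wire (n S : nat) : Type :=
  if S is S'.+1 then option (wire n S') else 'I_n.

Inductive gates (n : nat) : nat -> Type :=
| NoGate : gates n 0
| AddGate S : gates n S -> gate (wire n S) -> gates n S.+1.

Fixpoint wire_val (p n S : nat) (G : gates n S) (x : 'I_n -> bool) {struct G} :
    wire n S -> bool :=
  match G in gates _ S0 return wire n S0 -> bool with
  | NoGate => x
  | AddGate _ G' g => fun w =>
      if w is Some w' then wire_val p G' x w' else gate_val p (wire_val p G' x) g
  end.

(* Length of the longest path ending at a wire: inputs and fan-in-0 gates
   (constants) have depth 0, and NOT gates count like the others. *)
Fixpoint wire_depth (n S : nat) (G : gates n S) {struct G} : wire n S -> nat :=
  match G in gates _ S0 return wire n S0 -> nat with
  | NoGate => fun _ => 0%N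
  | AddGate _ G' g => fun w =>
      if w is Some w' then wire_depth G' w'
      else (\max_(a <- gate_inputs g) (wire_depth G' a).+1)%N
  end.

Record circuit (n : nat) := Circuit {
  circuit_size : nat;
  circuit_gates : gates n circuit_size;
  circuit_output : wire n circuit_size
}.

Definition circuit_depth n (C : circuit n) : nat :=
  wire_depth (circuit_gates C) (circuit_output C).

Definition circuit_val (p n : nat) (C : circuit n) (x : 'I_n -> bool) : bool :=
  wire_val p (circuit_gates C) x (circuit_output C).

Definition computes (p n : nat) (C : circuit n) (f : ('I_n -> bool) -> bool) :
    Prop :=
  forall x, circuit_val p C x = f x.

(* Main.v *)
Require Import Defs.
From HB Require Import structures.
From mathcomp Require Import all_boot all_order all_algebra.
From mathcomp Require Import all_classical all_reals all_analysis.
From mathcomp Require Import fintype finset finfield ring lra zify.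

(* Among 2k+1 hyperplanes of R^k in general position, k+1 affine forms are
   linearly dependent up to a constant, so some sign pattern on them is never
   feasible; and the other k hyperplanes meet in a vertex near which all 2^k
   patterns occur, so the pattern of that vertex on the first k+1 is feasible
   whatever the remaining signs.  Hence on each of the two fibers of f_H every function to F_p is a polynomial of degree
   at most k.  If f_H agreed with a polynomial of degree D on 3/4 of the cube,
   every function on that set would have degree at most k + D, and counting
   monomials gives D = Omega(sqrt k).  By the Razborov-Smolensky approximation, a
   circuit of depth d with S gates does agree with a polynomial of degree
   ((p-1) t)^d outside a fraction S / 2^t of the cube; take 2^t about 4 S. *)

Set Implicit Arguments.
Unset Strict Implicit.
Unset Printing Implicit Defensive.

Import Order.TTheory GRing.Theory Num.Theory.
Local Open Scope ring_scope.

(** * Polynomials on the cube *)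

Section CubePolynomials.
Variables (F : fieldType) (n : nat).
Implicit Types (X S : {set 'I_n}) (g h : {set 'I_n} -> F).

(* The points of the cube {0,1}^n are encoded as subsets X of 'I_n, so that the
   monomial prod_(i in S) x_i takes the value [S \subset X] at X. *)
Definition deg_le (d : nat) g : Prop :=
  exists c : {set 'I_n} -> F,
    forall X, g X = \sum_(S : {set 'I_n} | (#|S| <= d)%N) c S * (S \subset X)%:R.

Lemma eq_deg_le d g h : g =1 h -> deg_le d g -> deg_le d h.
Proof. by move=> gh [c gE]; exists c => X; rewrite -gh. Qed.

Lemma deg_le_monomial S : deg_le #|S| (fun X => (S \subset X)%:R).
Proof.
exists (fun S' => (S' == S)%:R) => X.
rewrite (bigD1 S) //= eqxx mul1r big1 ?addr0 // => S' /andP[_ /negPf ->].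
by rewrite mul0r.
Qed.

Lemma deg_leW d e g : (d <= e)%N -> deg_le d g -> deg_le e g.
Proof.
move=> de [c gE]; exists (fun S => if (#|S| <= d)%N then c S else 0) => X.
rewrite gE [RHS](bigID (fun S : {set 'I_n} => #|S| <= d)%N) /=.
rewrite [X in _ + X]big1 ?addr0 => [|S /andP[_ /negPf ->]]; last by rewrite mul0r.
apply: eq_big => [S|S ->] //.
by case: (leqP #|S| d) => [/leq_trans->|]; rewrite ?andbF.
Qed.

Lemma deg_leD d g h : deg_le d g -> deg_le d h -> deg_le d (fun X => g X + h X).
Proof.
move=> [c gE] [c' hE]; exists (fun S => c S + c' S) => X.
by rewrite gE hE -big_split; apply: eq_bigr => S _; rewrite mulrDl.
Qed.

Lemma deg_leZ d a g : deg_le d g -> deg_le d (fun X => a * g X).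
Proof.
move=> [c gE]; exists (fun S => a * c S) => X.
by rewrite gE mulr_sumr; apply: eq_bigr => S _; rewrite mulrA.
Qed.

Lemma deg_le_const d a : deg_le d (fun=> a).
Proof.
apply: (@deg_leW 0) => //; rewrite -(cards0 'I_n).
apply: eq_deg_le (deg_leZ a (deg_le_monomial set0)) => X.
by rewrite sub0set mulr1.
Qed.

Lemma deg_leB d g h : deg_le d g -> deg_le d h -> deg_le d (fun X => g X - h X).
Proof.
move=> dg dh; apply: eq_deg_le (deg_leD dg (deg_leZ (-1) dh)) => X.
by rewrite mulN1r.
Qed.

Lemma deg_le_sum (I : Type) (r : seq I) (P : pred I) d (g : I -> {set 'I_n} -> F) :
  (forall i, P i -> deg_le d (g i)) ->
  deg_le d (fun X => \sum_(i <- r | P i) g i X).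
Proof.
move=> dg; elim: r => [|i r IHr].
  by apply: eq_deg_le (deg_le_const d 0) => X; rewrite big_nil.
case Pi: (P i).
  apply: eq_deg_le (deg_leD (dg i Pi) IHr) => X.
  by rewrite big_cons Pi.
by apply: eq_deg_le IHr => X; rewrite big_cons Pi.
Qed.

Lemma deg_leM d e g h :
  deg_le d g -> deg_le e h -> deg_le (d + e) (fun X => g X * h X).
Proof.
move=> [c gE] [c' hE].
have dcc' : deg_le (d + e) (fun X => \sum_(S : {set 'I_n} | (#|S| <= d)%N)
    \sum_(S' : {set 'I_n} | (#|S'| <= e)%N)
      (c S * c' S') * (S :|: S' \subset X)%:R).
  apply: deg_le_sum => S dS; apply: deg_le_sum => S' dS'.
  apply/deg_leZ/(deg_leW _ (deg_le_monomial _)).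
  by rewrite (leq_trans (leq_card_setU _ _)) // leq_add.
apply: eq_deg_le dcc' => X; rewrite gE hE mulr_suml; apply: eq_bigr => S _.
rewrite mulr_sumr; apply: eq_bigr => S' _.
by rewrite subUset -mulnb natrM mulrACA.
Qed.

Lemma deg_leX d g q : deg_le d g -> deg_le (d * q) (fun X => g X ^+ q).
Proof.
move=> dg; elim: q => [|q IHq].
  by apply: eq_deg_le (deg_le_const _ 1) => X; rewrite expr0.
by rewrite mulnS; apply: eq_deg_le (deg_leM dg IHq) => X; rewrite exprS.
Qed.

Lemma deg_le_var i : deg_le 1 (fun X => (i \in X)%:R).
Proof.
rewrite -(cards1 i); apply: eq_deg_le (deg_le_monomial _) => X.
by rewrite sub1set.
Qed.

Lemma deg_le_prod (I : Type) (r : seq I) d (g : I -> {set 'I_n} -> F) :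
  (forall i, deg_le d (g i)) ->
  deg_le (size r * d) (fun X => \prod_(i <- r) g i X).
Proof.
move=> dg; elim: r => [|i r IHr].
  by apply: eq_deg_le (deg_le_const _ 1) => X; rewrite big_nil.
rewrite /= mulSn; apply: eq_deg_le (deg_leM (dg i) IHr) => X.
by rewrite big_cons.
Qed.

(** Lagrange interpolation: the indicator of each point [Y] is a product of [n] affine factors. *)
Lemma deg_le_full g : deg_le n g.
Proof.
have dY (Y : {set 'I_n}) : deg_le n (fun X => \prod_(i <- enum 'I_n)
    (if i \in Y then (i \in X)%:R else 1 - (i \in X)%:R)).
  apply: (@deg_leW (size (enum 'I_n) * 1)); first by rewrite muln1 size_enum_ord.
  apply: deg_le_prod => i; case: (i \in Y); first exact: deg_le_var.
  by apply: deg_leB; [apply: deg_le_const | apply: deg_le_var].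
have := deg_le_sum (index_enum {set 'I_n}) (P := predT)
  (fun Y _ => deg_leZ (g Y) (dY Y)).
apply: eq_deg_le => X; rewrite (bigD1 X) //= big1_seq ?mulr1; last first.
  by move=> i _; case: (i \in X); rewrite ?subr0.
rewrite big1 ?addr0 // => Y /eqP YX.
have [i Yi] : exists i, (i \in Y) != (i \in X).
  apply/existsP; apply: contra_notT YX => /existsPn YX.
  by apply/setP => i; apply/eqP; rewrite -[_ == _]negbK.
rewrite big_enum (bigD1 i) //=; move: Yi.
by case: (i \in Y); case: (i \in X) => //= _; rewrite ?subrr !mul0r mulr0.
Qed.

(** The leading monomials cancel. Peeling off [j] gives x_j A - (x_j - e_j) B = x_j (A - B) + e_j
    B. *)
Lemma deg_le_prod_shift (r : seq 'I_n) (e : 'I_n -> F) :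
  deg_le (size r).-1 (fun X => \prod_(i <- r) (i \in X)%:R
                              - \prod_(i <- r) ((i \in X)%:R - e i)).
Proof.
case: r => [|j r]; first by apply: eq_deg_le (deg_le_const _ 0) => X; rewrite !big_nil subrr.
elim: r j => [|i r IHr] j.
  by apply: eq_deg_le (deg_le_const _ (e j)) => X; rewrite !big_seq1 subKr.
have dB : deg_le (size (i :: r)) (fun X => \prod_(i <- i :: r) ((i \in X)%:R - e i)).
  rewrite -[size _]muln1; apply: deg_le_prod => l.
  by apply: deg_leB; [apply: deg_le_var | apply: deg_le_const].
apply: eq_deg_le (deg_leD (deg_leM (deg_le_var j) (IHr i)) (deg_leZ (e j) dB)) => X.
by rewrite !(big_cons _ _ j); ring.
Qed.

End CubePolynomials.

(* Fixing some pattern of k+1 bits makes f constantly true, another constantly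
   false; thus neither fiber of f shatters a (k+1)-set. *)
Definition versatile (n k : nat) (f : ('I_n -> bool) -> bool) : Prop :=
  forall (J : {set 'I_n}) (b : bool), (k < #|J|)%N ->
  exists a : 'I_n -> bool, forall s, {in J, s =1 a} -> f s = b.

Section Versatile.
Variables (F : fieldType) (n k : nat) (f : ('I_n -> bool) -> bool).
Hypothesis fV : versatile k f.
Implicit Types (X S : {set 'I_n}) (g h : {set 'I_n} -> F).

(* A pattern a absent on S in a fiber makes prod_(i in S) (x_i - (1 - a_i))
   vanish there, so the leading monomial x_S reduces to lower ones. *)
Lemma versatile_reduce_monomial b S : (k < #|S|)%N ->
  exists2 h : {set 'I_n} -> F, deg_le #|S|.-1 h &
    forall X, f (fun i => i \in X) = b -> (S \subset X)%:R = h X.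
Proof.
move=> kS; have [a aE] := fV (~~ b) kS.
pose e i : F := (~~ a i)%:R.
have := deg_le_prod_shift (enum S) e; rewrite -cardE => dh.
exists (fun X => \prod_(i <- enum S) (i \in X)%:R
                 - \prod_(i <- enum S) ((i \in X)%:R - e i)) => // X fX.
have [/eqfun_inP aX|] := boolP [forall i in S, (i \in X) == a i].
  by move: fX; rewrite aE //; case: (b).
rewrite negb_forall_in => /exists_inP[j jS aj].
rewrite !big_enum /= [X in _ - X](bigD1 j) //= /e.
have -> : (j \in X) = ~~ a j by move: aj; case: (j \in X); case: (a j).
rewrite subrr mul0r subr0.
have [SX|/subsetPn[i iS iX]] := boolP (S \subset X).
  by rewrite big1 // => i /(subsetP SX) ->.
by rewrite (bigD1 i) //= (negPf iX) mul0r.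
Qed.

(** Induction on the degree: on the fiber, a monomial of size above [k] is traded for a polynomial
    of smaller degree. *)
Lemma versatile_deg_le b g : exists2 h : {set 'I_n} -> F, deg_le k h &
  forall X, f (fun i => i \in X) = b -> g X = h X.
Proof.
suff red d g' : deg_le d g' -> exists2 h : {set 'I_n} -> F, deg_le k h &
    forall X, f (fun i => i \in X) = b -> g' X = h X.
  exact: red (deg_le_full g).
elim: d g' => [|d IHd] g' dg'.
  by exists g' => //; apply: deg_leW dg'.
have [c g'E] := dg'.
pose good (r : seq {set 'I_n}) := exists2 h : {set 'I_n} -> F, deg_le k h & forall X,
  f (fun i => i \in X) = b ->
  \sum_(S <- r | (#|S| <= d.+1)%N) c S * (S \subset X)%:R = h X.
suff [h dh hE] : good (index_enum {set 'I_n}).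
  by exists h => // X fX; rewrite g'E hE.
elim: (index_enum _) => [|S r [h dh hE]].
  by exists (fun=> 0); [apply: deg_le_const | move=> X _; rewrite big_nil].
case dS: (#|S| <= d.+1)%N; last by exists h => // X fX; rewrite big_cons dS hE.
have [hS dhS hSE] : exists2 h : {set 'I_n} -> F, deg_le k h &
    forall X, f (fun i => i \in X) = b -> (S \subset X)%:R = h X.
  have [Sk|kS] := leqP #|S| k.
    exists (fun X => (S \subset X)%:R) => //.
    exact: deg_leW Sk (deg_le_monomial F S).
  have [h1 dh1 h1E] := versatile_reduce_monomial b kS.
  have [|h2 dh2 h2E] := IHd h1; first by apply: deg_leW dh1; lia.
  by exists h2 => // X fX; rewrite h1E // h2E.
exists (fun X => c S * hS X + h X); first exact: deg_leD (deg_leZ _ dhS) dh.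
by move=> X fX; rewrite big_cons dS hSE // hE.
Qed.

(** On [A] the polynomial [P] tells the fibers apart, so it glues the two representatives of degree
    at most [k]. *)
Lemma versatile_approx_interpolate (D : nat) (A : {set {set 'I_n}})
    (P : {set 'I_n} -> F) :
  deg_le D P ->
  {in A, forall X, P X = (f (fun i => i \in X))%:R} ->
  forall g : {set 'I_n} -> F, exists2 h, deg_le (k + D) h & {in A, g =1 h}.
Proof.
move=> dP PE g.
have [g1 dg1 g1E] := versatile_deg_le true g.
have [g0 dg0 g0E] := versatile_deg_le false g.
exists (fun X => g1 X * P X + g0 X * (1 - P X)) => [|X XA].
  apply: deg_leD; apply: deg_leM => //.
  by apply: deg_leB => //; apply: deg_le_const.
rewrite PE //; case fX: (f _).
  by rewrite g1E // subrr mulr0 addr0 mulr1.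
by rewrite g0E // subr0 mulr0 add0r mulr1.
Qed.

End Versatile.

(** Evaluation maps coefficient vectors onto all functions on [A]; over a finite field, comparing
    the numbers of both gives the bound. *)
Lemma deg_le_interpolate_card (F : finFieldType) (n d : nat) (A : {set {set 'I_n}}) :
  (forall g : {set 'I_n} -> F, exists2 h, deg_le d h & {in A, g =1 h}) ->
  (#|A| <= #|[set S : {set 'I_n} | (#|S| <= d)%N]|)%N.
Proof.
move=> interp; set B := finset _.
pose tA := {X | X \in A}; pose tB := {S | S \in B}.
pose ev (c : {ffun tB -> F}) : {ffun tA -> F} :=
  [ffun X : tA => \sum_(S : tB) c S * (val S \subset val X)%:R].
have ev_onto (u : {ffun tA -> F}) : u \in codom ev.
  have [h [c hE] uh] :=
    interp (fun X => if insub X is Some Y then u (Y : tA) else 0).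
  apply/codomP; exists [ffun S : tB => c (val S)]; apply/ffunP => X.
  rewrite ffunE; have := uh _ (valP X); rewrite valK => ->.
  rewrite hE (reindex_omap (val : tB -> _) insub) /=; last first.
    by move=> S dS; rewrite insubT ?inE.
  apply: eq_big => [S|S _]; last by rewrite ffunE.
  by rewrite valK eqxx andbT; have := valP S; rewrite inE.
have : (#|{ffun tA -> F}| <= #|{ffun tB -> F}|)%N.
  rewrite -[leqRHS](size_codom ev).
  apply: leq_trans (card_size _); apply/subset_leq_card/subsetP => u _.
  exact: ev_onto.
by rewrite !card_ffun !card_sig leq_exp2l // finNzRing_gt1.
Qed.

(** * Sign vectors of an arrangement *)

Section Arrangements.
Variables (R : realType) (k : nat).
Implicit Types x u v : 'rV[R]_k.

Lemma dotpC u v : dotp u v = dotp v u.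
Proof. by apply: eq_bigr => l _; rewrite mulrC. Qed.

Lemma dotpE u v : dotp u v = (u *m v^T) 0 0.
Proof. by rewrite mxE; apply: eq_bigr => l _; rewrite mxE. Qed.

Lemma dotpDl u v x : dotp (u + v) x = dotp u x + dotp v x.
Proof. by rewrite !dotpE mulmxDl mxE. Qed.

Lemma dotpZl a u x : dotp (a *: u) x = a * dotp u x.
Proof. by rewrite !dotpE -scalemxAl mxE. Qed.

Variables (m : nat) (H : arrangement R k m).

Lemma f_arrP (s : 'I_m -> bool) :
  f_arr H s <-> exists x, forall i,
    if s i then offset H i < dotp x (normal H i)
    else dotp x (normal H i) < offset H i.
Proof.
split=> [/asboolP[x sx]|[x sx]]; [|apply/asboolP]; exists x => i; have := sx i.
  rewrite /sign_of_bit; case: (s i) => /eqP.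
    by rewrite sgr_cp0 subr_gt0.
  by rewrite sgr_cp0 subr_lt0.
rewrite /sign_of_bit; case: (s i) => sxi; apply/eqP.
  by rewrite sgr_cp0 subr_gt0.
by rewrite sgr_cp0 subr_lt0.
Qed.

(* Some nontrivial combination of the k+1 affine forms is a constant; the sign
   pattern giving every summand the opposite sign is infeasible. *)
Lemma f_arr_forced_false (J : {set 'I_m}) : (k < #|J|)%N ->
  exists a, forall s, {in J, s =1 a} -> f_arr H s = false.
Proof.
move=> kJ.
pose N : 'M[R]_(#|J|, k) := \matrix_(j < #|J|) normal H (enum_val j).
have [l lN l_neq0] : exists2 l : 'rV[R]_#|J|, l *m N = 0 & l != 0.
  have /rowV0Pn[l /sub_kermxP lN l_neq0] : kermx N != 0.
    by rewrite -mxrank_eq0 mxrank_ker -lt0n subn_gt0 (leq_ltn_trans (rank_leq_col _)).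
  by exists l.
(* Up to negating [l], the constant sum of l_j (<x, n_j> - b_j) is nonnegative, while the pattern
   chosen below makes every summand nonpositive. *)
wlog l_off : l lN l_neq0 / \sum_(j < #|J|) l 0 j * offset H (enum_val j) <= 0.
  move=> wl; have [|l_off] := leP (\sum_(j < #|J|) l 0 j * offset H (enum_val j)) 0.
    exact: wl l_neq0.
  apply: (wl (- l)); rewrite ?oppr_eq0 ?mulNmx ?lN ?oppr0 //.
  rewrite -oppr_ge0 -sumrN; apply: le_trans (ltW l_off) _; apply: ler_sum => j _.
  by rewrite mxE mulNr opprK.
have [j0 J0] : exists j, j \in J by apply/card_gt0P; rewrite (leq_ltn_trans _ kJ).
exists (fun i => l 0 (enum_rank_in J0 i) < 0) => s sJ.
apply/negbTE/negP => /f_arrP[x sx].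
have l_dotp : \sum_(j < #|J|) l 0 j * dotp x (normal H (enum_val j)) = 0.
  transitivity ((l *m N *m x^T) 0 0); last by rewrite lN mul0mx mxE.
  rewrite -mulmxA mxE; apply: eq_bigr => j _; congr (_ * _).
  rewrite dotpC dotpE -[normal H _](rowK (fun j => normal H (enum_val j))) -row_mul.
  by rewrite mxE.
have sl j : if l 0 j < 0 then offset H (enum_val j) < dotp x (normal H (enum_val j))
            else dotp x (normal H (enum_val j)) < offset H (enum_val j).
  by have := sx (enum_val j); rewrite sJ ?enum_valP // enum_valK_in.
have le_j j : l 0 j * dotp x (normal H (enum_val j)) <= l 0 j * offset H (enum_val j).
  have := sl j; case: ltP => lj hj; first by rewrite ler_nM2l // ltW.
  by apply: ler_wpM2l => //; exact: ltW.
(* Nonnegative terms whose sum is at most 0 all vanish; since the inequalities [sl] are strict, [l]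
   will have to be 0. *)
have eq_j j : l 0 j * offset H (enum_val j) - l 0 j * dotp x (normal H (enum_val j)) = 0.
  have: \sum_(j < #|J|) (l 0 j * offset H (enum_val j)
          - l 0 j * dotp x (normal H (enum_val j))) == 0.
    rewrite eq_le sumr_ge0 => [|i _]; last by rewrite subr_ge0.
    by rewrite andbT sumrB l_dotp subr0.
  rewrite psumr_eq0 => [/allP/(_ j)|i _]; last by rewrite subr_ge0.
  by rewrite mem_index_enum => /(_ isT)/eqP.
case/eqP: l_neq0; apply/rowP => j; rewrite [RHS]mxE.
have /eqP := eq_j j; rewrite -mulrBr mulf_eq0 => /orP[/eqP //|].
by rewrite subr_eq0 => /eqP Ej; have := sl j; rewrite Ej ltxx if_same.
Qed.

Hypothesis Hgp : general_position H.

(* The k hyperplanes outside J meet in a vertex lying on no other hyperplane,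
   and all 2^k sign patterns outside J occur near that vertex. *)
Lemma f_arr_forced_true (J : {set 'I_m}) : #|~: J| = k ->
  exists a, forall s, {in J, s =1 a} -> f_arr H s = true.
Proof.
move=> cJ; set K := ~: J.
have [flats empty] := Hgp.
have [|v [V [dimV vV]]] := flats K; first by rewrite cJ.
rewrite cJ subnn in dimV.
have {V dimV vV} vK w : common_points H K w <-> w = v.
  have /eqP V0 : V == 0%VS by rewrite -dimv_eq0 dimV.
  by rewrite vV V0 memv0 subr_eq0; split=> [/eqP|->].
have vK0 : common_points H K v by apply/vK.
have vJ i : i \in J -> dotp v (normal H i) != offset H i.
  move=> iJ; apply/eqP => vi.
  apply: (empty (i |: K) _ v); first by rewrite cardsU1 in_setC iJ cJ.
  move=> j; rewrite in_setU1 => /predU1P[->|/vK0 //].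
  by rewrite /on_hyperplane dotpC.
exists (fun i => offset H i < dotp v (normal H i)) => s sJ; apply/f_arrP.
pose M : 'M[R]_(k, #|K|) := \matrix_(l, j) normal H (enum_val j) 0 l.
have ME w j : (w *m M) 0 j = dotp w (normal H (enum_val j)).
  by rewrite mxE; apply: eq_bigr => l _; rewrite mxE.
(* If [w] is orthogonal to the normals in [K], then [v + w] is also a common point, hence equals
   [v]. As [M] is square, any signs on [K] can then be prescribed. *)
have M_free : row_free M.
  apply/inj_row_free => w wM.
  apply: (addrI v); rewrite addr0; apply/vK => i iK.
  rewrite /on_hyperplane dotpC dotpDl dotpC (vK0 i iK).
  by rewrite -(enum_rankK_in iK iK) -ME wM mxE addr0.
have [u uM] : exists u : 'rV[R]_k, \row_(j < #|K|) (-1) ^+ (~~ s (enum_val j)) = u *m M.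
  by apply/submxP/submx_full; rewrite /row_full (eqP M_free) cJ.
have uK i : i \in K -> dotp u (normal H i) = (-1) ^+ (~~ s i).
  by move=> iK; rewrite -(enum_rankK_in iK iK) -ME -uM mxE.
pose del i := dotp v (normal H i) - offset H i.
(* A step of length [f i] along [u] does not cross hyperplane [i]; the added 1 avoids division by
   zero and makes [epsJ] strict. *)
pose f i := if i \in J then `|del i| / (1 + `|dotp u (normal H i)|) else 1.
have u1_gt0 i : 0 < 1 + `|dotp u (normal H i)| by rewrite ltr_pwDl.
pose eps := \big[Order.min/1]_i f i.
have eps_gt0 : 0 < eps.
  apply/bigmin_gtP; split=> // i _; rewrite /f; case: ifP => // iJ.
  by rewrite divr_gt0 // normr_gt0 subr_eq0 vJ.
have epsJ i : i \in J -> eps * `|dotp u (normal H i)| < `|del i|.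
  move=> iJ; have : eps <= f i by apply: bigmin_le_cond.
  rewrite /f iJ ler_pdivlMr // mulrDr mulr1; apply: lt_le_trans.
  by rewrite ltrDr.
exists (v + eps *: u) => i; rewrite dotpDl dotpZl.
have [iJ|iJ] := boolP (i \in J).
  rewrite sJ //; have := epsJ i iJ; rewrite /del.
  move: (vJ i iJ) => /eqP; set q := dotp v _; set w := dotp u _ => qo.
  rewrite -[eps in eps * _]gtr0_norm // -normrM; move: (eps * w) => e.
  case: (ltP (offset H i) q) => hq.
    by rewrite [`|q - _|]gtr0_norm ?subr_gt0 // ltr_norml => /andP[]; lra.
  have {}hq : q < offset H i by rewrite lt_neqAle hq andbT; apply/eqP.
  by rewrite [`|q - _|]ltr0_norm ?subr_lt0 // ltr_norml => /andP[]; lra.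
have iK : i \in K by rewrite in_setC.
rewrite -subr_gt0 -[X in if _ then _ else X]subr_gt0.
have -> : dotp v (normal H i) = offset H i by rewrite dotpC; apply: vK0.
rewrite uK //; case: (s i) => /=; lra.
Qed.

(** Shrinking [J] to k+1 elements leaves exactly k of the 2k+1 hyperplanes outside, as the vertex
    argument requires. *)
Lemma f_arr_versatile : m = (2 * k + 1)%N -> versatile k (f_arr H).
Proof.
move=> mE J [] kJ; last exact: f_arr_forced_false.
have [J' /subsetP J'J cJ'] : exists2 J' : {set 'I_m}, J' \subset J & #|J'| = k.+1.
  have /card_geqP[r [ur rk rJ]] := kJ.
  exists [set x in r]; last by rewrite cardsE (card_uniqP ur) rk.
  by apply/subsetP => x; rewrite inE => /rJ.
have [|a aE] := @f_arr_forced_true J'; first by rewrite cardsCs setCK card_ord; lia.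
by exists a => s sJ; apply: aE => i /J'J; apply: sJ.
Qed.

End Arrangements.

(** * Razborov-Smolensky approximation *)

Section Approximation.
Variables (p n : nat).
Hypothesis p_prime : prime p.
Notation F := 'F_p.
Implicit Types (g h q : {set 'I_n} -> F) (A : {set {set 'I_n}}).

Lemma Fp_indicator (x : F) : x ^+ p.-1 = (x != 0)%:R.
Proof.
have [->|x_neq0] := eqVneq x 0.
  by rewrite expr0n; have := prime_gt1 p_prime; case: (p) => [|[]].
apply: (mulfI x_neq0); rewrite mulr1 -exprS prednK ?prime_gt0 //.
by rewrite -{2}(expf_card x) card_Fp.
Qed.

(* Deciding greedily, function by function, whether to include it in a partial
   sum keeps the sum nonzero on half of the points considered so far. *)
Lemma subsum_nonzero_half e (gs : seq ({set 'I_n} -> F)) A :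
  (forall i, deg_le e (nth (fun=> 0) gs i)) ->
  {in A, forall X, has (fun g => g X != 0) gs} ->
  exists q, [/\ deg_le e q,
    forall X, ~~ has (fun g => g X != 0) gs -> q X = 0 &
    (2 * #|[set X in A | q X == 0%R]| <= #|A|)%N].
Proof.
elim: gs A => [|g gs IHgs] A dgs hA.
  exists (fun=> 0); split=> //; first exact: deg_le_const.
  have -> : [set X in A | 0 == 0 :> F] = set0.
    by apply/setP => X; rewrite !inE; apply/andP => -[/hA].
  by rewrite cards0 muln0.
pose A0 := [set X in A | g X == 0]; pose A1 := [set X in A | g X != 0].
have [|X|q [dq q0 qA]] := IHgs A0; first by move=> i; apply: (dgs i.+1).
  by rewrite inE => /andP[/hA /= hX /eqP gX]; rewrite gX eqxx in hX.
have cA : #|A| = (#|A0| + #|A1|)%N.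
  rewrite -(cardsID [set X | g X == 0] A); congr (_ + _)%N.
    by apply: eq_card => X; rewrite !inE.
  by apply: eq_card => X; rewrite !inE andbC.
(* Where [g] is nonzero, [q] and [q + g] cannot both vanish, so one of the two zero sets covers at
   most half of [A1]. *)
pose Z b := [set X in A1 | q X + (b : bool)%:R * g X == 0].
have cZ : (#|Z false| + #|Z true| <= #|A1|)%N.
  rewrite -cardsUI [X in (_ + X)%N]eq_card0 ?addn0; last first.
    move=> X; rewrite !inE mul0r addr0 mul1r; apply/negP.
    case/andP=> /andP[/andP[_ gX] /eqP ->] /andP[_].
    by rewrite add0r (negPf gX).
  by apply/subset_leq_card/subsetP => X; rewrite !inE; case/orP => /andP[].
have [b Zb] : exists b, (2 * #|Z b| <= #|A1|)%N.
  case: (leqP #|Z true| #|Z false|) => hZ; [exists true | exists false]; lia.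
exists (fun X => q X + b%:R * g X); split.
- by apply: deg_leD dq (deg_leZ _ (dgs 0%N)).
- by move=> X /=; rewrite negb_or negbK => /andP[/eqP-> /q0 ->]; rewrite mulr0 addr0.
- apply: (@leq_trans (2 * (#|[set X in A0 | q X == 0%R]| + #|Z b|))); last by rewrite cA; lia.
  rewrite leq_mul2l /= -cardsUI; apply: leq_trans (leq_addr _ _).
  apply/subset_leq_card/subsetP => X; rewrite !inE.
  have [gX|gX] := eqVneq (g X) 0; last by rewrite andbT => /andP[-> ->]; rewrite orbT.
  by rewrite gX mulr0 addr0 andbT => /andP[-> ->].
Qed.

(** The approximant is a product of [t] factors 1 - q^(p-1), each [q] chosen for the points still in
    error and correcting at least half of them. *)
Lemma nor_approx e (gs : seq ({set 'I_n} -> F)) t :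
  (forall i, deg_le e (nth (fun=> 0) gs i)) ->
  exists h, [/\ deg_le (e * (p.-1 * t)) h,
    forall X, ~~ has (fun g => g X != 0) gs -> h X = 1 &
    (2 ^ t * #|[set X | has (fun g => g X != 0%R) gs & h X != 0%R]| <= 2 ^ n)%N].
Proof.
move=> dgs; elim: t => [|t [h [dh h1 hc]]].
  exists (fun=> 1); split=> //; first exact: deg_le_const.
  by rewrite mul1n (leq_trans (max_card _)) // -cardsT -powersetT card_powerset cardsT card_ord.
set A := finset _ in hc.
have [|q [dq q0 qA]] := @subsum_nonzero_half e gs A dgs.
  by move=> X; rewrite inE => /andP[].
exists (fun X => h X * (1 - q X ^+ p.-1)); split.
- rewrite mulnS mulnDr addnC; apply: deg_leM dh _.
  by apply: deg_leB (deg_le_const _ _ _) (deg_leX _ dq).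
- by move=> X gX; rewrite h1 // Fp_indicator q0 // eqxx subr0 mulr1.
- apply: leq_trans hc; rewrite expnSr -mulnA leq_mul2l.
  apply/orP; right; apply: leq_trans qA; rewrite leq_mul2l /=.
  apply/subset_leq_card/subsetP => X; rewrite !inE Fp_indicator => /andP[->].
  by have [_|_] := eqVneq (q X) 0; rewrite ?subrr ?subr0 ?mulr1 ?mulr0 ?eqxx // => ->.
Qed.


(** The predicate [r] confines the degree hypothesis to a class of wires containing the inputs of
    the gate. *)
Lemma or_approx (W : Type) e (r : pred W) (a : seq W) (P : W -> {set 'I_n} -> F) t :
  all r a -> (forall w, r w -> deg_le e (P w)) ->
  exists h (B : {set {set 'I_n}}), [/\ deg_le (e * (p.-1 * t)) h,
    (2 ^ t * #|B| <= 2 ^ n)%N &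
    forall X, X \notin B -> h X = (has (fun w => P w X != 0) a)%:R].
Proof.
move=> ra dP; pose gs := [seq P w | w <- a].
have [|h [dh h1 hB]] := @nor_approx e gs t.
  move: ra; rewrite {}/gs; elim: a => [_|w a IHa /= /andP[rw ra]] i.
    by rewrite nth_nil; apply: deg_le_const.
  by case: i => [|i]; [exact: dP | exact: IHa].
exists (fun X => 1 - h X), [set X | has (fun g => g X != 0) gs & h X != 0].
split=> // [|X]; first by apply: deg_leB => //; apply: deg_le_const.
have -> : has (fun w => P w X != 0) a = has (fun g => g X != 0) gs.
  by rewrite has_map.
rewrite inE.
case gX: (has _ gs); last by rewrite h1 ?gX ?subrr.
by rewrite negbK => /eqP ->; rewrite subr0.
Qed.

(** AND reduces to OR by De Morgan; MOD_p, through Fermat's little theorem, and NOT are represented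
    without error. *)
Lemma gate_approx (W : Type) (dep : W -> nat) (P : W -> {set 'I_n} -> F) t
    (g : gate W) :
  (0 < t)%N -> (forall w, deg_le ((p.-1 * t) ^ dep w) (P w)) ->
  exists h (B : {set {set 'I_n}}), [/\
    deg_le ((p.-1 * t) ^ \max_(w <- gate_inputs g) (dep w).+1) h,
    (2 ^ t * #|B| <= 2 ^ n)%N &
    forall X (v : W -> bool), X \notin B -> (forall w, P w X = (v w)%:R) ->
      h X = (gate_val p v g)%:R].
Proof.
move=> t_gt0 dP; set D := (p.-1 * t)%N in dP *.
have p1_gt0 : (0 < p.-1)%N by have := prime_gt1 p_prime; lia.
have D_gt0 : (0 < D)%N by rewrite muln_gt0 p1_gt0.
(* [e] is [D] to the power one less than the depth of the gate. At depth 0 there are no inputs, [r]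
   is empty and [e] is 0. *)
have [e [r [ra dr eD eleD]]] : exists e (r : pred W), [/\ all r (gate_inputs g),
    forall w, r w -> deg_le e (P w),
    (e * D <= D ^ \max_(w <- gate_inputs g) (dep w).+1)%N &
    (e <= D ^ \max_(w <- gate_inputs g) (dep w).+1)%N].
  set dg := (\max_(w <- _) _)%N.
  have ra : all (fun w => dep w < dg)%N (gate_inputs g).
    rewrite /dg; elim: (gate_inputs g) => //= w a IHa.
    rewrite big_cons leq_maxl /=; apply: sub_all IHa => w' /leq_trans; apply.
    exact: leq_maxr.
  exists (if dg is dg'.+1 then (D ^ dg')%N else 0%N), (fun w => dep w < dg)%N.
  case: {+}dg ra => [|dg'] ra; split=> //.
  - by move=> w; rewrite ltnS => wdg; apply: deg_leW (dP w); rewrite leq_pexp2l.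
  - by rewrite expnSr.
  - by rewrite leq_pexp2l.
have PE X (v : pred W) : (forall w, P w X = (v w)%:R) -> forall w, (P w X != 0) = v w.
  by move=> Pv w; rewrite Pv; case: (v w); rewrite ?oner_eq0 ?eqxx.
case: g ra eD eleD => [a|a|a|w] /= ra eD eleD.
- have [|h [B [dh cB hE]]] := @or_approx W e r a (fun w X => 1 - P w X) t ra.
    by move=> w rw; apply: deg_leB (dr w rw); apply: deg_le_const.
  exists (fun X => 1 - h X), B; split=> //.
    by apply: deg_leB; [apply: deg_le_const | apply: deg_leW dh].
  move=> X v XB Pv; rewrite hE // (@eq_has _ _ (predC v)) => [|w /=].
    by rewrite has_predC; case: (all v a); rewrite ?subr0 ?subrr.
  by rewrite Pv; case: (v w); rewrite ?subrr ?subr0 ?oner_eq0 ?eqxx.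
- have [h [B [dh cB hE]]] := @or_approx W e r a P t ra dr.
  exists h, B; split=> //; first exact: deg_leW dh.
  by move=> X v XB /PE Pv; rewrite hE // (eq_has Pv).
(* Filtering by [r] drops no input, but bounds the degree of every summand. *)
- exists (fun X => 1 - (\sum_(w <- a | r w) P w X) ^+ p.-1), set0; split.
  + apply: deg_leB; first exact: deg_le_const.
    apply: (@deg_leW _ _ (e * p.-1)).
      by apply: leq_trans eD; rewrite leq_mul2l leq_pmulr ?orbT.
    exact/deg_leX/deg_le_sum.
  + by rewrite cards0 muln0.
  + move=> X v _ Pv; rewrite Fp_indicator.
    have -> : \sum_(w <- a | r w) P w X = (count v a)%:R.
      elim: a ra {eD eleD} => [|w a IHa] /=; first by rewrite big_nil.
      by case/andP=> rw ra; rewrite big_cons rw IHa // natrD Pv.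
    rewrite -(dvdn_pcharf (pchar_Fp p_prime)).
    by case: (p %| _)%N; rewrite ?subr0 ?subrr.
- exists (fun X => 1 - P w X), set0; split.
  + apply: deg_leB; first exact: deg_le_const.
    by apply: deg_leW eleD _; apply: dr; move: ra => /andP[].
  + by rewrite cards0 muln0.
  + by move=> X v _ ->; case: (v w); rewrite /= ?subrr ?subr0.
Qed.

(** The error sets of the gates are united: outside the union every gate receives exact inputs, so
    errors do not propagate. *)
Lemma gates_approx S (G : gates n S) t : (0 < t)%N ->
  exists (P : wire n S -> {set 'I_n} -> F) (B : {set {set 'I_n}}), [/\
    forall w, deg_le ((p.-1 * t) ^ wire_depth G w) (P w),
    (2 ^ t * #|B| <= S * 2 ^ n)%N &
    forall X, X \notin B -> forall w,
      P w X = (wire_val p G (fun i => i \in X) w)%:R].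
Proof.
move=> t_gt0; elim: S / G => [|S G [P [B [dP cB PE]]] g].
  exists (fun (i : 'I_n) (X : {set 'I_n}) => (i \in X)%:R), set0; split=> //; first exact: deg_le_var.
  by rewrite cards0 muln0.
have [h [B' [dh cB' hE]]] := gate_approx g t_gt0 dP.
exists (fun w => if w is Some w' then P w' else h), (B :|: B'); split.
- by case.
- rewrite mulSn addnC (leq_trans _ (leq_add cB cB')) // -mulnDr.
  by rewrite leq_mul2l leq_card_setU orbT.
- move=> X; rewrite inE negb_or => /andP[XB XB'] [w|] /=; first exact: PE.
  by rewrite (hE _ _ XB' (PE _ XB)).
Qed.

End Approximation.

(** * Degree and size lower bounds *)

(** The induction step comes down to (2k+1)(2k+3) <= 4(k+1)^2. *)
Lemma central_bin_bound k : ((2 * k + 1) * 'C(2 * k, k) ^ 2 <= 16 ^ k)%N.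
Proof.
elim: k => [|k IHk]; first by rewrite bin0.
have step : (k.+1 * 'C(2 * k.+1, k.+1) = 2 * (2 * k + 1) * 'C(2 * k, k))%N.
  rewrite -mul_bin_diag -[RHS]mulnA addn1.
  rewrite (mul_bin_down (2 * k).+1 k) mulnA mulnS /=.
  by congr (_ * _)%N; lia.
have e16 : (16 ^ k.+1 = 16 * 16 ^ k)%N by rewrite expnS.
rewrite e16 -(@leq_pmul2l (k.+1 ^ 2)) ?expn_gt0 //.
have -> : (k.+1 ^ 2 * ((2 * k.+1 + 1) * 'C(2 * k.+1, k.+1) ^ 2)
          = (2 * k + 3) * (k.+1 * 'C(2 * k.+1, k.+1)) ^ 2)%N.
  by rewrite expnMn; lia.
rewrite step; nia.
Qed.

Lemma middle_bin_bound k : ((2 * k + 3) * 'C(2 * k + 1, k.+1) ^ 2 <= 4 ^ (2 * k + 1))%N.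
Proof.
have := central_bin_bound k.+1.
have -> : 'C(2 * k.+1, k.+1) = (2 * 'C(2 * k + 1, k.+1))%N.
  rewrite mulnS addnC addn2 addn1 binS [RHS]mul2n -addnn; congr (_ + _)%N.
  rewrite -(@bin_sub (2 * k).+1 k.+1); last lia.
  by have -> : ((2 * k).+1 - k.+1 = k)%N by lia.
have -> : (4 ^ (2 * k + 1) = 4 * 16 ^ k)%N by rewrite addn1 expnS expnM.
rewrite expnMn (expnS 16); lia.
Qed.

Lemma bin_le_middle k i : (k < i)%N -> ('C(2 * k + 1, i) <= 'C(2 * k + 1, k.+1))%N.
Proof.
move=> /subnKC <-; elim: (i - _)%N => [|j IHj]; first by rewrite addn0.
apply: leq_trans IHj; rewrite (addnS k.+1); have := mul_bin_left (2 * k + 1) (k.+1 + j).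
move=> E; rewrite -(@leq_pmul2l (k.+1 + j).+1) // E leq_mul2r; apply/orP; right; lia.
Qed.

(** Complementation exchanges these sets with the remaining ones, so they are half of all. *)
Lemma card_small_sets k : #|[set S : {set 'I_(2 * k + 1)} | (#|S| <= k)%N]| = (2 ^ (2 * k))%N.
Proof.
set B := finset _.
have cBC : #|~: B| = #|B|.
  rewrite -(card_imset B (@setC_inj _)); apply: eq_card => S; rewrite !inE.
  apply/idP/imsetP => [hS|[S' + ->]].
    by exists (~: S); rewrite ?setCK // inE cardsCs setCK card_ord; lia.
  by rewrite inE (cardsCs (~: S')) setCK card_ord; lia.
have := cardsC B; rewrite cBC -[#|{: _}|]cardsT -powersetT card_powerset cardsT card_ord.
by move: #|B| => b; rewrite addn1 expnS; lia.
Qed.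

Lemma card_sets_le k D :
  (#|[set S : {set 'I_(2 * k + 1)} | (#|S| <= k + D)%N]|
     <= 2 ^ (2 * k) + D * 'C(2 * k + 1, k.+1))%N.
Proof.
elim: D => [|D IHD]; first by rewrite addn0 mul0n addn0 card_small_sets.
have mid : ('C(2 * k + 1, k + D.+1) <= 'C(2 * k + 1, k.+1))%N.
  by apply: bin_le_middle; lia.
apply: (@leq_trans (#|[set S : {set 'I_(2 * k + 1)} | (#|S| <= k + D)%N]|
                    + 'C(2 * k + 1, k + D.+1))); last lia.
rewrite -[X in 'C(X, _)](card_ord (2 * k + 1)) -card_draws.
apply: leq_trans (leq_card_setU _ _); apply/subset_leq_card/subsetP => S.
by rewrite !inE; move: #|S| => x; lia.
Qed.

Lemma versatile_approx_degree k (f : ('I_(2 * k + 1) -> bool) -> bool)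
    (F : finFieldType) D (P : {set 'I_(2 * k + 1)} -> F) (B : {set {set 'I_(2 * k + 1)}}) :
  versatile k f -> deg_le D P ->
  (forall X, X \notin B -> P X = (f (fun i => i \in X))%:R) ->
  (4 * #|B| <= 2 ^ (2 * k + 1))%N -> (k <= 16 * D ^ 2)%N.
Proof.
move=> fV dP PE cB.
have PE' : {in ~: B, forall X, P X = (f (fun i => i \in X))%:R}.
  by move=> X; rewrite inE; apply: PE.
have := deg_le_interpolate_card (versatile_approx_interpolate fV dP PE').
move/leq_trans => /(_ _ (card_sets_le _ _)).
have := cardsC B; rewrite -[#|{: _}|]cardsT -powersetT card_powerset cardsT card_ord.
have := middle_bin_bound k; move: cB.
have -> : (4 ^ (2 * k + 1) = (2 ^ (2 * k + 1)) ^ 2)%N by rewrite -[4%N]/(2 ^ 2)%N expnAC.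
have : (0 < 'C(2 * k + 1, k.+1))%N by rewrite bin_gt0; lia.
move: #|B| #|~: B| 'C(_, _) => b a c; rewrite addn1 expnS; move: (2 ^ _)%N => N.
move=> c_gt0 h1 h2 h3 h4.
(* Here [N] is 2^(2k): at least 3N/2 of the 2N points are good, and at most N + D c can be. *)
have {h1 h3 h4} h : (N <= 2 * D * c)%N by lia.
have : ((2 * k + 3) * c ^ 2 <= 16 * D ^ 2 * c ^ 2)%N.
  apply: leq_trans h2 _; rewrite -[16%N]/(4 ^ 2)%N -!expnMn leq_sqr; lia.
by rewrite leq_pmul2r ?expn_gt0 ?c_gt0 //; lia.
Qed.

(** * Excluding circuits with at most one gate *)

Lemma versatile_edge n k (f : ('I_n -> bool) -> bool) (i : 'I_n) b :
  versatile k f -> (k.+1 < n)%N ->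
  exists a, forall c, f (fun j => if j == i then c else a j) = b.
Proof.
move=> fV kn; have [|a aE] := fV (~: [set i]) b.
  by rewrite cardsCs setCK cards1 card_ord; lia.
by exists a => c; apply: aE => j; rewrite !inE => /negPf ->.
Qed.

(** In each direction [f] has an edge with value true at both ends and one with value false at both,
    which no AND, OR or NOT gate reading that input allows. *)
Lemma versatile_not_gate p n k (f : ('I_n -> bool) -> bool) (g : gate 'I_n) :
  versatile k f -> (k.+1 < n)%N -> ~ (forall x, gate_val p x g = f x).
Proof.
move=> fV kn gE; have edge i b := versatile_edge i b fV kn.
have n_gt0 : (0 < n)%N by lia.
have nconst b : ~ (forall x, f x = b).
  move=> fb; have [a aE] := edge (Ordinal n_gt0) (~~ b).
  by have := aE true; rewrite fb; case: (b).
case: g gE => [a|a|a|i] gE.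
- case: a gE => [|i a] gE; first by apply: (nconst true) => x; rewrite -gE.
  have [e /(_ false)] := edge i true.
  by rewrite -gE /= eqxx.
- case: a gE => [|i a] gE; first by apply: (nconst false) => x; rewrite -gE.
  have [e /(_ true)] := edge i false.
  by rewrite -gE /= eqxx.
- apply: (nconst true) => x; rewrite -gE /=.
  have -> : count x a = (\sum_(i < n) x i * count_mem i a)%N.
    elim: a {gE} => [|j a IHa]; first by rewrite big1 // => i _; rewrite muln0.
    rewrite /= IHa [in RHS](eq_bigr (fun i => x i * (j == i) + x i * count_mem i a)%N).
      rewrite big_split /=; congr (_ + _)%N; rewrite (bigD1 j) //= eqxx muln1 big1 ?addn0 // => i /negPf.
      by rewrite eq_sym => ->; rewrite muln0.
    by move=> i _; rewrite mulnDr.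
  apply: dvdn_sum => i _; apply: dvdn_mull.
  (* The counts at the ends of this edge differ by the multiplicity of [i], and [p] divides both.
     Hence [p] divides every multiplicity and the gate is constant. *)
  have [e eE] := edge i true.
  have := eE true; have := eE false; rewrite -!gE /= => e0.
  rewrite (_ : count _ a = (count_mem i a +
                            count (fun j => if j == i then false else e j) a)%N).
    by rewrite dvdn_addl.
  by elim: (a) => //= j r ->; case: (j == i); lia.
- have [e /(_ true)] := edge i true.
  by rewrite -gE /= eqxx.
Qed.

(** Positive depth ensures that [w] is not an input, so it is the output of the only gate. *)
Lemma one_gate_circuit p n S (G : gates n S) (w : wire n S) :
  (S <= 1)%N -> (0 < wire_depth G w)%N ->
  exists g : gate 'I_n, forall x, wire_val p G x w = gate_val p x g.
Proof.
case: S / G w => // S G g w; case: S / G g w => // g [|] //= _ _.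
by exists g.
Qed.

(** * From the degree bound to the size bound *)

Lemma powR_le_root (R : realType) (k a q : nat) : (0 < q)%N ->
  (k <= a ^ q)%N -> (k%:R : R) `^ (1 / q%:R) <= a%:R.
Proof.
move=> q_gt0 ka.
have q_neq0 : (q%:R : R) != 0 by rewrite pnatr_eq0 -lt0n.
have -> : a%:R = (a%:R `^ q%:R) `^ (1 / q%:R) :> R.
  by rewrite -powRrM mulrC divfK // powRr1.
rewrite powR_mulrn // -natrX; apply: ge0_ler_powR; rewrite ?nnegrE //.
by rewrite ler_nat.
Qed.

Theorem theorem1 (R : realType) (p : nat) (p_prime : prime p) :
  exists c : R, 0 < c /\
    forall (d k : nat), (1 <= d)%N -> (1 <= k)%N ->
    forall H : arrangement R k (2 * k + 1), general_position H ->
    forall C : circuit (2 * k + 1),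
      circuit_depth C = d -> computes p C (f_arr H) ->
      expR (c * (k%:R `^ (1 / (2 * d%:R)))) <= (circuit_size C)%:R.
Proof.
have p1_gt0 : (0 < p.-1)%N by have := prime_gt1 p_prime; lia.
have ln2_gt0 : 0 < ln (2 : R) by rewrite ln_gt0 // ltr1n.
(* The root of k will be at most 4 (p-1) (l+3) with l = floor(log2 S); the factor 16 then uses l + 3
   <= 4 l. *)
exists (ln 2 / (16 * p.-1%:R)); split; first by rewrite divr_gt0 // mulr_gt0 ?ltr0n.
move=> d k d_gt0 k_gt0 H Hgp [S G w] /= dC fC.
rewrite /circuit_depth /= in dC; rewrite /computes /circuit_val /= in fC.
have fV := f_arr_versatile Hgp erefl.
(* Two gates are needed for [l] to be positive. *)
have S_gt1 : (1 < S)%N.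
  rewrite ltnNge; apply/negP => S_le1.
  have w_gt0 : (0 < wire_depth G w)%N by rewrite dC.
  have [g gE] := one_gate_circuit p S_le1 w_gt0.
  apply: (versatile_not_gate (p := p) (g := g) fV); first lia.
  by move=> x; rewrite -gE fC.
pose l := trunc_log 2 S.
have [lS Sl] : (2 ^ l <= S)%N /\ (S < 2 ^ l.+1)%N.
  by apply/andP/trunc_log_bounds => //; lia.
have l_gt0 : (0 < l)%N by rewrite trunc_log_gt0.
(* With t = l + 3, 2^t = 4 * 2^(l+1) exceeds 4 S, so the error set is at most a quarter of the
   cube. *)
pose D := (p.-1 * (l + 3))%N.
have kD : (k <= (4 * D) ^ (2 * d))%N.
  have [|P [B [dP cB PE]]] := @gates_approx p _ p_prime S G (l + 3); first lia.
  have : (k <= 16 * (D ^ d) ^ 2)%N.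
    apply: (versatile_approx_degree fV (P := P w) (B := B)).
    - by rewrite /D -dC.
    - by move=> X XB; rewrite PE // fC.
    - rewrite -(@leq_pmul2l (2 ^ l.+1)) ?expn_gt0 // mulnA -[4%N]/(2 ^ 2)%N -expnD.
      rewrite addSn -addnS; apply: leq_trans cB _.
      by rewrite leq_mul2r ltnW ?orbT.
  move=> /leq_trans; apply; rewrite -expnM mulnC (mulnC 2 d) expnMn mulnC.
  by rewrite leq_mul2r -[16%N]/(4 ^ 2)%N leq_pexp2l ?orbT //; lia.
have kR : (k%:R : R) `^ (1 / (2 * d%:R)) <= (4 * D)%:R.
  by rewrite -natrM; apply: powR_le_root kD; lia.
have {}lS : expR (ln 2 * l%:R) <= S%:R :> R.
  by rewrite expRM_natr lnK ?posrE // -natrX ler_nat.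
apply: le_trans lS; rewrite ler_expR.
apply: le_trans (ler_wpM2l _ kR) _; first by rewrite divr_ge0 // ltW.
rewrite /D mulnA !natrM natrD.
have -> : ln 2 / (16 * p.-1%:R) * (4 * p.-1%:R * (l%:R + 3))
          = ln 2 * ((l%:R + 3) / 4) :> R.
  by field; rewrite pnatr_eq0 -lt0n.
rewrite ler_pM2l // ler_pdivrMr //.
have : 1 <= l%:R :> R by rewrite ler1n.
lra.
Qed.
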